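(* Let $\lambda,n,m$ be positive integers with $1<n<m$ and $\gcd(n,m)=1$, and let $X(S)=\mathcal{V}(I_S)\subset\mathbb{C}^4$ be the toric surface generated by the semigroup $S=\langle (1,0),(\lambda,1),(0,n),(0,m)\rangle$. Let $q$, $h_0,\dots,h_q$, $r_0=n,r_1,\dots,r_q=1$ be given by the successive division of $m$ by $n$ (see context). Then the set $\mathcal{G}$ consisting of the following binomials is a generating set for the ideal $I_S\subset\mathbb{C}[X,Y,Z,W]$: $Y^n-X^{\lambda n}Z$, $Y^{r_1}Z^{h_0}-X^{\lambda r_1}W$, and $$Y^{a_{k,j}}W^{b_{k,j}}-X^{\lambda a_{k,j}}Z^{d_{k,j}}\quad\text{for } k \text{ odd},$$ $$Y^{a_{k,j}}Z^{d_{k,j}}-X^{\lambda a_{k,j}}W^{b_{k,j}}\quad\text{for } k\text{ even},$$ where for each fixed $k\in\{1,\ldots,q\}$ the exponents are given, for $j\in\{1,\ldots,h_k\}$, by $$a_{k,j}=r_{k-1}-r_k\cdot j,\qquad b_{k,j}=b_{k-1,h_{k-1}}\cdot j+b_{k-2,h_{k-2}},\qquad d_{k,j}=d_{k-1,h_{k-1}}\cdot j+d_{k-2,h_{k-2}},$$ with $b_{-1,h_{-1}}:=0$, $b_{0,h_0}:=1$, $d_{-1,h_{-1}}:=1$ and $d_{0,h_0}:=h_0$.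
   Context: For the generators $\gamma_1=(1,0),\gamma_2=(\lambda,1),\gamma_3=(0,n),\gamma_4=(0,m)$ of $S$, let $\pi_S:\mathbb{Z}^4\to\mathbb{Z}^2$, $\pi_S(\alpha)=\sum_i\alpha_i\gamma_i$. Then $I_S=\langle x^{\alpha_+}-x^{\alpha_-}:\alpha\in\mathrm{Ker}(\pi_S)\rangle\subset\mathbb{C}[X,Y,Z,W]$, where $\alpha=\alpha_+-\alpha_-$ is the decomposition into positive and negative parts and $x^\beta=X^{\beta_1}Y^{\beta_2}Z^{\beta_3}W^{\beta_4}$; $X(S)=\mathcal{V}(I_S)$ is its zero set. Successive division: $m=h_0n+r_1$, $n=h_1r_1+r_2$, $r_1=h_2r_2+r_3$, $\dots$, $r_{q-2}=h_{q-1}r_{q-1}+r_q$, $r_{q-1}=h_qr_q$, with $h_0,h_i,r_i$ positive integers for $i=1,\dots,q$, $r_0:=n$, $0<r_i<r_{i-1}$, and $r_q=\gcd(n,m)=1$. *)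

(* Defs.v *)
From mathcomp Require Import all_boot all_order all_algebra.
From mathcomp Require Import complex reals.
From mathcomp Require Import mpoly.

Set Implicit Arguments.
Unset Strict Implicit.
Unset Printing Implicit Defensive.

Import GRing.Theory Num.Theory.

Local Open Scope ring_scope.

(* [pi_S] and the generators of S live in Z^2 = int * int, Z^4 is the type of
   functions 'I_4 -> int, and the exponents of X, Y, Z, W are the coordinates
   0, 1, 2, 3. *)
Definition gens (lam n m : nat) : 4.-tuple (int * int) :=
  [tuple (1, 0); (lam%:Z, 1); (0, n%:Z); (0, m%:Z)].

Definition pi_S (lam n m : nat) (alpha : 'I_4 -> int) : int * int :=
  \sum_(i < 4) tnth (gens lam n m) i *~ alpha i.

Definition pos_part (alpha : 'I_4 -> int) : 'X_{1..4} :=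
  [multinom `|Num.max (alpha i) 0|%N | i < 4].

Definition neg_part (alpha : 'I_4 -> int) : 'X_{1..4} :=
  [multinom `|Num.max (- alpha i) 0|%N | i < 4].

Definition ideal_gen (A : comPzRingType) (P : A -> Prop) (f : A) : Prop :=
  exists2 s : seq (A * A),
    forall cg, cg \in s -> P cg.2 & f = \sum_(cg <- s) cg.1 * cg.2.

Section ToricIdeal.

Variable R : realType.

Definition toric_ideal (lam n m : nat) : {mpoly R[i][4]} -> Prop :=
  ideal_gen (fun f => exists2 alpha : 'I_4 -> int,
    pi_S lam n m alpha = 0 & f = 'X_[pos_part alpha] - 'X_[neg_part alpha]).

End ToricIdeal.

Definition successive_division (n m q : nat) (h r : nat -> nat) : Prop :=
  [/\ (0 < q)%N,
      r 0%N = n /\ r q = gcdn n m,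
      (forall i, (i <= q)%N -> (0 < h i)%N) /\
        (forall i, (0 < i <= q)%N -> (0 < r i < r i.-1)%N),
      m = (h 0 * n + r 1)%N /\
        (forall i, (0 < i < q)%N -> r i.-1 = (h i * r i + r i.+1)%N)
    & r q.-1 = (h q * r q)%N].

(* The common recursion of b_{k,j} and d_{k,j}; [cm1] and [c0] are the values
   at (-1, h_{-1}) and (0, h_0), the latter being returned at k = 0 whatever
   j is. *)
Fixpoint expo (cm1 c0 : nat) (h : nat -> nat) (k j : nat) : nat :=
  match k with
  | 0 => c0
  | k1.+1 => expo cm1 c0 h k1 (h k1) * j +
      match k1 with
      | 0 => cm1
      | k2.+1 => expo cm1 c0 h k2 (h k2)
      end
  end.

(* No truncation when 0 < k <= q and j <= h k, as r k * h k <= r k.-1. *)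
Definition a_exp (r : nat -> nat) (k j : nat) : nat := r k.-1 - r k * j.
Definition b_exp (h : nat -> nat) (k j : nat) : nat := expo 0 1 h k j.
Definition d_exp (h : nat -> nat) (k j : nat) : nat := expo 1 (h 0) h k j.

Section GeneratingSet.

Variable R : realType.

Let X : {mpoly R[i][4]} := 'X_(@Ordinal 4 0 isT).
Let Y : {mpoly R[i][4]} := 'X_(@Ordinal 4 1 isT).
Let Z : {mpoly R[i][4]} := 'X_(@Ordinal 4 2 isT).
Let W : {mpoly R[i][4]} := 'X_(@Ordinal 4 3 isT).

Definition binom_G (lam : nat) (h r : nat -> nat) (k j : nat) :
    {mpoly R[i][4]} :=
  let a := a_exp r k j in
  let b := b_exp h k j in
  let d := d_exp h k j in
  if odd k then Y ^+ a * W ^+ b - X ^+ (lam * a) * Z ^+ d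
  else Y ^+ a * Z ^+ d - X ^+ (lam * a) * W ^+ b.

Definition set_G (lam n q : nat) (h r : nat -> nat) : seq {mpoly R[i][4]} :=
  [:: Y ^+ n - X ^+ (lam * n) * Z;
      Y ^+ r 1%N * Z ^+ h 0%N - X ^+ (lam * r 1%N) * W] ++
  [seq binom_G lam h r k j | k <- iota 1 q, j <- iota 1 (h k)].

End GeneratingSet.

(* Main.v *)
(** An element of the kernel of [pi_S] is determined by its last two
    coordinates, so up to sign it is given by a pair [(c, d)] of naturals in one
    of the cones [n c <= m d] and [m d <= n c], or by [c, d] with equal signs,
    which reduces to [(c, 0)] and [(0, d)].  For a fixed cone, the pairs whose
    binomial lies in the ideal generated by [set_G] form a monoid.  Put
    [v 0 = (0, 1)], [v 1 = (1, 0)] and [v i.+2 = h i * v i.+1 + v i].  The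
    generators are the binomials of the intermediate convergents
    [v i + j * v i.+1], which lie in the cone fixed by the parity of [i].
    Write a pair as [x v i + y v i.+1]: if [y <= h i * x], it is a sum of [x]
    such convergents, otherwise it is [(y - h i * x) v i.+1 + x v i.+2].  This
    ends at [v q.+2 = (m, n)], which lies on the common ray of the two cones. *)

Require Import Defs.
From mathcomp Require Import all_boot all_order all_algebra.
From mathcomp Require Import complex reals.
From mathcomp Require Import mpoly.
From mathcomp Require Import zify ring.

Import GRing.Theory Num.Theory.

Local Open Scope ring_scope.

(** * Closure properties and congruences of generated ideals *)

Section IdealGen.

Context {A : comPzRingType}.
Implicit Types (P : A -> Prop) (f g a : A).

Lemma mem_ideal_gen P f : P f -> ideal_gen P f.
Proof.
move=> Pf; exists [:: (1, f)]; last by rewrite big_seq1 mul1r.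
by move=> cg; rewrite inE => /eqP ->.
Qed.

Lemma ideal_gen0 P : ideal_gen P 0.
Proof. by exists [::] => //; rewrite big_nil. Qed.

Lemma ideal_genD P f g : ideal_gen P f -> ideal_gen P g -> ideal_gen P (f + g).
Proof.
move=> [s Ps ->] [s' Ps' ->]; exists (s ++ s'); last by rewrite big_cat.
by move=> cg; rewrite mem_cat => /orP[/Ps|/Ps'].
Qed.

Lemma ideal_genM P a f : ideal_gen P f -> ideal_gen P (a * f).
Proof.
move=> [s Ps ->]; exists [seq (a * cg.1, cg.2) | cg <- s].
  by move=> _ /mapP[cg /Ps ? ->].
by rewrite big_map mulr_sumr; apply: eq_bigr => cg _; rewrite mulrA.
Qed.

Lemma ideal_genN P f : ideal_gen P f -> ideal_gen P (- f).
Proof. by rewrite -mulN1r; apply: ideal_genM. Qed.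

Lemma ideal_gen_sub P Q f :
  (forall g, P g -> ideal_gen Q g) -> ideal_gen P f -> ideal_gen Q f.
Proof.
move=> PQ [s Ps ->]; rewrite big_seq; elim/big_ind: _ => //.
- exact: ideal_gen0.
- by move=> *; apply: ideal_genD.
- by move=> cg /Ps /PQ; apply: ideal_genM.
Qed.

Lemma ideal_gen_trans P f g h :
  ideal_gen P (f - g) -> ideal_gen P (g - h) -> ideal_gen P (f - h).
Proof. by move=> fg gh; rewrite -(subrKA g); apply: ideal_genD. Qed.

Lemma ideal_gen_mul P f g f' g' : ideal_gen P (f - g) ->
  ideal_gen P (f' - g') -> ideal_gen P (f * f' - g * g').
Proof.
move=> fg fg'; apply: (@ideal_gen_trans _ _ (f * g')).
  by rewrite -mulrBr; apply: ideal_genM.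
by rewrite -mulrBl mulrC; apply: ideal_genM.
Qed.

End IdealGen.

(** * Convergents of a continued fraction *)

(** Started at [(0, 1)] this gives the numerators of the continued fraction [[h 0; h 1, ...]],
    started at [(1, 0)] its denominators: the two coordinates of [v i]. *)
Fixpoint convergent (x0 x1 : nat) (h : nat -> nat) (i : nat) : nat :=
  match i with
  | 0 => x0
  | i1.+1 => match i1 with
    | 0 => x1
    | i2.+1 => h i2 * convergent x0 x1 h i1 + convergent x0 x1 h i2
    end
  end.

Lemma convergentSS x0 x1 h i : convergent x0 x1 h i.+2 =
  (h i * convergent x0 x1 h i.+1 + convergent x0 x1 h i)%N.
Proof. by []. Qed.

(* The index of [convergent] is shifted by two from the one of the paper, so
   that the pair [(0, 1)] can be put in front of [(1, 0)] and [(h 0, 1)]. *)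
Lemma expo_convergent x0 x1 h k j :
  expo x1 (convergent x0 x1 h 2) h k.+1 j =
  (convergent x0 x1 h k.+2 * j + convergent x0 x1 h k.+1)%N.
Proof.
have expo_last i :
    expo x1 (convergent x0 x1 h 2) h i (h i) = convergent x0 x1 h i.+2.
  elim/ltn_ind: i => -[|[|i]] IH //; first by rewrite [RHS]convergentSS mulnC.
  rewrite [RHS]convergentSS -(IH i.+1) // -(IH i) //.
  by rewrite [LHS]/= mulnC.
by case: k => [|k] //; rewrite -(expo_last k.+1) -(expo_last k).
Qed.

(** * Binomials attached to pairs, and their monoid structure *)

Section Lifting.

Context {A : comPzRingType} (P : A -> Prop) (lam : nat) (X Y : A).

(* The binomial attached to [(c, d)] when [0 <= t := m d - n c]. *)
Definition lifted (n m : nat) (Z W : A) (c d : nat) : Prop :=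
  exists2 t, (m * d = n * c + t)%N &
    ideal_gen P (Y ^+ t * Z ^+ c - X ^+ (lam * t) * W ^+ d).

Lemma lifted0 n m Z W : lifted n m Z W 0 0.
Proof.
by exists 0%N; rewrite ?muln0 // !expr0 !mulr1 subrr; apply: ideal_gen0.
Qed.

Lemma liftedD n m Z W c d c' d' : lifted n m Z W c d -> lifted n m Z W c' d' ->
  lifted n m Z W (c + c') (d + d').
Proof.
move=> [t E J] [t' E' J']; exists (t + t')%N; first by lia.
by rewrite mulnDr !exprD mulrACA [X in _ - X]mulrACA; apply: ideal_gen_mul.
Qed.

Lemma liftedM n m Z W c d k : lifted n m Z W c d ->
  lifted n m Z W (k * c) (k * d).
Proof.
move=> L; elim: k => [|k IH]; first exact: lifted0.
by rewrite !mulSn; apply: liftedD.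
Qed.

(** On the common ray [t = 0], so the two binomials are opposite. *)
Lemma lifted_swap n m Z W c d : (n * c = m * d)%N ->
  lifted n m Z W c d -> lifted m n W Z d c.
Proof.
move=> E [t Et J]; exists 0%N; first by lia.
have t0 : t = 0%N by lia.
move: J; rewrite t0 muln0 !mul1r => J.
by rewrite -opprB; apply: ideal_genN.
Qed.

(** Modulo the ideal, [Y ^+ t'] can be traded for [X ^+ (lam * t') * Z ^+ e], which supplies the
    missing factor [Z ^+ e]. *)
Lemma lifted_subl n m Z W c e d :
  lifted n m Z W (c + e) d -> lifted m n W Z 0 e -> lifted n m Z W c d.
Proof.
move=> [t E J] [t' E' J']; exists (t + t')%N; first by lia.
apply: (@ideal_gen_trans _ _ _ (Y ^+ t * Z ^+ c * (X ^+ (lam * t') * Z ^+ e))).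
  rewrite exprD mulrAC; apply: ideal_gen_mul; last by rewrite mulr1 in J'.
  by rewrite subrr; apply: ideal_gen0.
have -> : Y ^+ t * Z ^+ c * (X ^+ (lam * t') * Z ^+ e) =
    X ^+ (lam * t') * (Y ^+ t * Z ^+ (c + e)) by rewrite exprD; ring.
have -> : X ^+ (lam * (t + t')) * W ^+ d =
    X ^+ (lam * t') * (X ^+ (lam * t) * W ^+ d) by rewrite mulnDr exprD; ring.
by rewrite -mulrBr; apply: ideal_genM.
Qed.

Variables (n m : nat) (Z W : A).

(** The boolean stands for the parity of a convergent's index; [true] is the cone [m d <= n c]. *)
Definition side (b : bool) (c d : nat) : Prop :=
  if b then lifted m n W Z d c else lifted n m Z W c d.

Lemma side0 b : side b 0 0.
Proof. by case: b; apply: lifted0. Qed.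

Lemma sideD b c d c' d' : side b c d -> side b c' d' ->
  side b (c + c') (d + d').
Proof. by case: b; apply: liftedD. Qed.

Lemma sideM b c d k : side b c d -> side b (k * c) (k * d).
Proof. by case: b; apply: liftedM. Qed.

Lemma side_swap b c d : (n * c = m * d)%N -> side b c d -> side (~~ b) c d.
Proof. by move=> E; case: b; apply: lifted_swap. Qed.

(* [x u + y v] with [y <= h x] is a sum of [x] vectors [u + j v], [j <= h]. *)
Lemma side_fan b h x y c d c' d' : (y <= h * x)%N ->
  (forall j, (j <= h)%N -> side b (c + j * c') (d + j * d')) ->
  side b (x * c + y * c') (x * d + y * d').
Proof.
move=> + fan; elim: x y => [|x IH] y le_y.
  have -> : y = 0%N by lia.
  exact: side0.
(* Greedy choice: one vector absorbs [min(y, h)] copies of [v], the other [x] share the rest. *)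
have [lt_yh|le_hy] := ltnP y h.
  have E e f : (x.+1 * e + y * f = (e + y * f) + (x * e + 0 * f))%N by lia.
  by rewrite !E; apply: sideD; [apply: fan; apply: ltnW | apply: IH].
have E e f : (x.+1 * e + y * f = (e + h * f) + (x * e + (y - h) * f))%N by nia.
by rewrite !E; apply: sideD; [apply: fan | apply: IH; lia].
Qed.

(** * Descent along the convergents *)

Section Euclid.

Variables (q : nat) (h s : nat -> nat).
Hypotheses (s0 : s 0 = m) (s1 : s 1 = n).
Hypothesis sE : forall i, (i <= q)%N -> s i = (h i * s i.+1 + s i.+2)%N.

Local Notation cv := (convergent 0 1 h).
Local Notation dv := (convergent 1 0 h).

(** [m * dv i - n * cv i] obeys the recursion of the convergents, [s i] the same one with [h i]
    negated; so they agree up to the sign [(-1)^i]. *)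
Lemma convergent_remainder i : (i <= q.+2)%N ->
  if odd i then (n * cv i = m * dv i + s i)%N
  else (m * dv i = n * cv i + s i)%N.
Proof.
elim/ltn_ind: i => -[|[|i]] IH lei; rewrite ?convergentSS.
- by rewrite /= s0; lia.
- by rewrite /= s1; lia.
have := sE i lei; have := IH i.+1 (ltnSn _) (ltnW lei).
have := IH i (leqnSn _) (ltnW (ltnW lei)).
by rewrite /= negbK; case: (odd i) => /= *; nia.
Qed.

(** Since [j <= h i], the remainder stays nonnegative and the cone is that of [v i]. This remainder
    is the exponent [a_exp] of [Y]. *)
Lemma convergent_remainderD i j : (i <= q)%N -> (j <= h i)%N ->
  if odd i
  then (n * (cv i + j * cv i.+1) =
        m * (dv i + j * dv i.+1) + (s i - s i.+1 * j))%N
  else (m * (dv i + j * dv i.+1) =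
        n * (cv i + j * cv i.+1) + (s i - s i.+1 * j))%N.
Proof.
move=> lei lej; have := sE i lei.
have := @convergent_remainder i ltac:(lia).
have := @convergent_remainder i.+1 ltac:(lia).
by rewrite [odd i.+1]/=; case: (odd i) => /= *; nia.
Qed.

Hypothesis s_last : s q.+2 = 0%N.
Hypothesis h_gt0 : forall i, (i <= q)%N -> (0 < h i)%N.
Hypothesis gen1 : side true 1 0.
Hypothesis gen2 : side false (h 0) 1.
Hypothesis gens_side : forall i j, (0 < i <= q)%N -> (0 < j <= h i)%N ->
  side (odd i) (cv i + j * cv i.+1) (dv i + j * dv i.+1).

(** From [i = 3] on, [v i] is the last intermediate convergent, [j = h (i - 2)], of the fan of index
    [i - 2]. *)
Lemma side_convergent i : (0 < i <= q.+2)%N -> side (odd i) (cv i) (dv i).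
Proof.
case: i => [|[|[|i]]] //=; first by rewrite muln1 addn0 muln0.
move=> lei; have /= := gens_side i.+1 (h i.+1).
by rewrite negbK addnC [X in side _ _ X]addnC; apply; rewrite ?lei ?h_gt0 /=.
Qed.

(** The fan [i = 0] has only its end [v 2 = (h 0, 1)] among the generators; [(j, 1)] follows by
    removing [h 0 - j] copies of [v 1]. *)
Lemma side_intermediate i j : (i <= q)%N -> (j <= h i)%N ->
  side (odd i) (cv i + j * cv i.+1) (dv i + j * dv i.+1).
Proof.
case: i => [|i] lei lej.
  rewrite /= muln1 muln0 add0n addn0; apply: (@lifted_subl _ _ _ _ _ (h 0 - j)).
    by rewrite subnKC.
  by have := @sideM true _ _ (h 0 - j)%N gen1; rewrite muln0 muln1.
case: j lej => [|j] lej; last by apply: gens_side.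
by rewrite !addn0; apply: side_convergent; lia.
Qed.

(** Induction on the distance [k] to the last pair of convergents; [b] is the parity of the index
    where the descent stops. *)
Lemma side_cone k i x y : (i + k = q.+1)%N -> exists b,
  side b (x * cv i + y * cv i.+1) (x * dv i + y * dv i.+1).
Proof.
elim: k i x y => [|k IH] i x y Ei.
  have {Ei} -> : i = q.+1 by lia.
  exists (odd q.+1); apply: sideD; apply: sideM.
    by apply: side_convergent; lia.
  (* The remainder of [v q.+2] is 0, so it can change sides to join [v q.+1]. *)
  have -> : odd q.+1 = ~~ odd q.+2 by rewrite /= !negbK.
  apply: side_swap; last by apply: side_convergent; lia.
  have := @convergent_remainder q.+2 (leqnn _).
  by rewrite s_last !addn0; case: odd.
have [le_y|/ltnW le_y] := leqP y (h i * x).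
  exists (odd i); apply: side_fan le_y _ => j lej.
  by apply: side_intermediate; lia.
have [b] := IH i.+1 (y - h i * x)%N x ltac:(lia).
rewrite !convergentSS => sb; exists b.
have E e f : (x * e + y * f = (y - h i * x) * f + x * (h i * f + e))%N by nia.
by rewrite !E.
Qed.

Lemma side_total c d : exists b, side b c d.
Proof.
have [b] := side_cone q.+1 0 d c erefl.
by rewrite /= !muln0 !muln1 addn0; exists b.
Qed.

Lemma lifted_total c d t : (m * d = n * c + t)%N ->
  ideal_gen P (Y ^+ t * Z ^+ c - X ^+ (lam * t) * W ^+ d).
Proof.
move=> E; suff [t' E' J] : lifted n m Z W c d.
  by have -> : t = t' by lia.
(* If the descent ends on the other side, the pair lies in both cones, hence on their common ray. *)
have [[] sb] := side_total c d; last exact: sb.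
by apply: lifted_swap (sb); case: sb => t' E' _; lia.
Qed.

Lemma lifted_total_swap c d t : (n * c = m * d + t)%N ->
  ideal_gen P (Y ^+ t * W ^+ d - X ^+ (lam * t) * Z ^+ c).
Proof.
move=> E; suff [t' E' J] : lifted m n W Z d c.
  by have -> : t = t' by lia.
have [[] sb] := side_total c d; first exact: sb.
by apply: lifted_swap (sb); case: sb => t' E' _; lia.
Qed.

End Euclid.
End Lifting.

(** * Reduction of kernel vectors to the two cones *)

Definition nat_part (a : int) : nat := `|Num.max a 0|%N.

Lemma nat_part_nat (k : nat) : nat_part k = k.
Proof. by rewrite /nat_part; lia. Qed.

Lemma nat_part_opp (k : nat) : nat_part (- k%:Z) = 0%N.
Proof. by rewrite /nat_part; lia. Qed.

Section Kernel.

Context {A : comPzRingType} (P : A -> Prop) (lam n m : nat) (X Y Z W : A).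
Hypotheses (n_gt0 : (0 < n)%N) (m_gt0 : (0 < m)%N).
Hypothesis total : forall c d t, (m * d = n * c + t)%N ->
  ideal_gen P (Y ^+ t * Z ^+ c - X ^+ (lam * t) * W ^+ d).
Hypothesis total_swap : forall c d t, (n * c = m * d + t)%N ->
  ideal_gen P (Y ^+ t * W ^+ d - X ^+ (lam * t) * Z ^+ c).

Local Notation mono a b c d :=
  (X ^+ nat_part a * Y ^+ nat_part b * Z ^+ nat_part c * W ^+ nat_part d).

Lemma kernel_binomial (a b c d : int) : a + lam%:Z * b = 0 ->
  b + n%:Z * c + m%:Z * d = 0 ->
  ideal_gen P (mono a b c d - mono (- a) (- b) (- c) (- d)).
Proof.
(* Negating the kernel vector negates its binomial, so the exponent of [Y] may be taken
   nonnegative. *)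
have wlog_pos (t : nat) c' d' : t%:Z + n%:Z * c' + m%:Z * d' = 0 ->
  ideal_gen P (mono (- (lam * t)%N%:Z) t c' d'
               - mono (lam * t)%N (- t%:Z) (- c') (- d')).
  rewrite !(nat_part_nat, nat_part_opp) !expr0 mul1r mulr1.
  have int_cases (e : int) : exists k : nat, e = k \/ e = - k%:Z.
    by exists `|e|%N; lia.
  have [u []->] := int_cases c'; have [v []->] := int_cases d' => E;
    rewrite ?opprK !(nat_part_nat, nat_part_opp) !expr0 ?mulr1.
  - have {E} [-> -> ->] : [/\ t = 0, u = 0 & v = 0]%N by split; nia.
    by rewrite muln0 !expr0 !mulr1 subrr; apply: ideal_gen0.
  - by apply: total; lia.
  - by apply: total_swap; lia.
  (* Here the binomial comes from multiplying the congruences of [(u, 0)] and [(0, v)]. *)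
  - have -> : t = (n * u + m * v)%N by lia.
    rewrite mulnDr !exprD -mulrA mulrACA mulrC [X in _ - X]mulrC.
    have := @total_swap u 0 (n * u) ltac:(lia).
    have := @total 0 v (m * v) ltac:(lia).
    rewrite !expr0 !mulr1 => J J'; have := ideal_gen_mul _ _ _ _ _ J' J.
    by congr (ideal_gen P (_ - _)); ring.
move=> Ea E; case: (intP b) Ea E => [|k|k] Ea E.
- have -> : a = - (lam * 0)%N%:Z by lia.
  by rewrite opprK; apply: wlog_pos.
- have -> : a = - (lam * k.+1)%N%:Z by lia.
  by rewrite opprK; apply: wlog_pos.
- have -> : a = (lam * k.+1)%N%:Z by lia.
  rewrite -opprB opprK -{2}[c]opprK -{2}[d]opprK; apply: ideal_genN.
  by apply: wlog_pos; lia.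
Qed.

End Kernel.

(** * The toric ideal in coordinates *)

Section Toric.

Context {R : realType}.

Local Notation o0 := (@Ordinal 4 0 isT).
Local Notation o1 := (@Ordinal 4 1 isT).
Local Notation o2 := (@Ordinal 4 2 isT).
Local Notation o3 := (@Ordinal 4 3 isT).
Local Notation X := ('X_o0 : {mpoly R[i][4]}).
Local Notation Y := ('X_o1 : {mpoly R[i][4]}).
Local Notation Z := ('X_o2 : {mpoly R[i][4]}).
Local Notation W := ('X_o3 : {mpoly R[i][4]}).

Lemma big_ord4 (T : Type) (idx : T) (op : Monoid.law idx) (F : 'I_4 -> T) :
  \big[op/idx]_i F i = op (op (op (F o0) (F o1)) (F o2)) (F o3).
Proof.
rewrite !big_ord_recl big_ord0 Monoid.mulm1 !Monoid.mulmA.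
by congr (op (op (op (F _) (F _)) (F _)) (F _)); apply: val_inj.
Qed.

Lemma mpolyX4 (e : 'X_{1..4}) :
  'X_[e] = X ^+ e o0 * Y ^+ e o1 * Z ^+ e o2 * W ^+ e o3.
Proof. by rewrite [LHS]mpolyXE_id big_ord4. Qed.

Lemma pi_S_eq0 lam n m alpha : pi_S lam n m alpha = 0 <->
  alpha o0 + lam%:Z * alpha o1 = 0 /\
  alpha o1 + n%:Z * alpha o2 + m%:Z * alpha o3 = 0.
Proof.
have -> : pi_S lam n m alpha = (alpha o0 + lam%:Z * alpha o1,
    alpha o1 + n%:Z * alpha o2 + m%:Z * alpha o3).
  rewrite [LHS]surjective_pairing /pi_S; congr pair;
    rewrite raddf_sum big_ord4 /=.
    by rewrite !(raddfMz fst) /= !mulrzz; lia.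
  by rewrite !(raddfMz snd) /= !mulrzz; lia.
by split=> [[-> ->]|[-> ->]].
Qed.

Lemma part_binomial (alpha : 'I_4 -> int) :
  'X_[pos_part alpha] - 'X_[neg_part alpha] =
  X ^+ nat_part (alpha o0) * Y ^+ nat_part (alpha o1) *
    Z ^+ nat_part (alpha o2) * W ^+ nat_part (alpha o3) -
  X ^+ nat_part (- alpha o0) * Y ^+ nat_part (- alpha o1) *
    Z ^+ nat_part (- alpha o2) * W ^+ nat_part (- alpha o3).
Proof. by rewrite (mpolyX4 (pos_part _)) (mpolyX4 (neg_part _)) !mnmE. Qed.

Lemma toric_ideal_lifted lam n m c d t : (m * d = n * c + t)%N ->
  @toric_ideal R lam n m (Y ^+ t * Z ^+ c - X ^+ (lam * t) * W ^+ d).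
Proof.
move=> E; apply: mem_ideal_gen.
exists (nth 0 [:: - (lam * t)%N%:Z; t%:Z; c%:Z; - d%:Z]).
  by apply/pi_S_eq0; rewrite /=; lia.
rewrite part_binomial /= !opprK !(nat_part_nat, nat_part_opp).
by rewrite !expr0 !mulr1 mul1r.
Qed.

Lemma toric_ideal_lifted_swap lam n m c d t : (n * c = m * d + t)%N ->
  @toric_ideal R lam n m (Y ^+ t * W ^+ d - X ^+ (lam * t) * Z ^+ c).
Proof.
move=> E; apply: mem_ideal_gen.
exists (nth 0 [:: - (lam * t)%N%:Z; t%:Z; - c%:Z; d%:Z]).
  by apply/pi_S_eq0; rewrite /=; lia.
rewrite part_binomial /= !opprK !(nat_part_nat, nat_part_opp).
by rewrite !expr0 !mulr1 mul1r.
Qed.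

End Toric.

Theorem theorem4p5 (R : realType) (lam n m q : nat) (h r : nat -> nat)
    (lam_gt0 : (0 < lam)%N) (n_gt1 : (1 < n)%N) (n_lt_m : (n < m)%N)
    (gcd_nm : gcdn n m = 1%N) (hdiv : successive_division n m q h r)
    (f : {mpoly R[i][4]}) :
  ideal_gen (fun g => g \in set_G R lam n q h r) f
  <-> toric_ideal lam n m f.
Proof.
have [q_gt0 [r0 _] [h_gt0 _] [m_div r_div] r_last] := hdiv.
(* Shifting [r] by one puts [m] in front, and the final 0 turns the exact last division into an
   instance of the common recursion. *)
pose s i := if i is k.+1 then if (k <= q)%N then r k else 0%N else m.
have s1 : s 1 = n by [].
have s_last : s q.+2 = 0%N by rewrite /s ltnn.
have sE i : (i <= q)%N -> s i = (h i * s i.+1 + s i.+2)%N.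
  case: i => [|i] le_iq; first by rewrite /s leq0n q_gt0 r0.
  rewrite /s ltnW // le_iq; have [lt_iq|le_qi] := ltnP i.+1 q.
    exact: (r_div i.+1).
  have Eq : q = i.+1 by lia.
  by move: r_last; rewrite Eq addn0.
have bE k j : b_exp h k.+1 j =
    (convergent 1 0 h k.+1 + j * convergent 1 0 h k.+2)%N.
  rewrite addnC mulnC -expo_convergent /b_exp.
  by rewrite convergentSS /= muln0.
have dE k j : d_exp h k.+1 j =
    (convergent 0 1 h k.+1 + j * convergent 0 1 h k.+2)%N.
  rewrite addnC mulnC -expo_convergent /d_exp.
  by rewrite convergentSS /= muln1 addn0.
have aE k j : (k < q)%N -> a_exp r k.+1 j = (s k.+1 - s k.+2 * j)%N.
  by move=> lt_kq; rewrite /a_exp /s ltnW // lt_kq.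
split; apply: ideal_gen_sub => g.
  rewrite mem_cat !inE => /orP[/orP[]/eqP->|].
  - rewrite -[_ ^+ n]mulr1 -['X_(@Ordinal 4 2 _)]expr1.
    by apply: (@toric_ideal_lifted_swap _ _ _ _ 1 0); lia.
  - rewrite -['X_(@Ordinal 4 3 _)]expr1.
    by apply: toric_ideal_lifted; lia.
  case/allpairsPdep => -[|k] [j [+ + ->]]; rewrite !mem_iota // => lek lej.
  (* The remainder identity says that the exponents of the generator form a kernel vector. *)
  have := @convergent_remainderD n m q h s erefl s1 sE k.+1 j
    ltac:(lia) ltac:(lia).
  rewrite -bE -dE -aE /binom_G; last by lia.
  by case: odd => E; [apply: toric_ideal_lifted_swap|apply: toric_ideal_lifted].
case=> alpha /pi_S_eq0[E1 E2] ->; rewrite part_binomial.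
set P := fun g => _.
pose sd := side P lam 'X_(@Ordinal 4 0 isT) 'X_(@Ordinal 4 1 isT) n m
  'X_(@Ordinal 4 2 isT) 'X_(@Ordinal 4 3 isT).
have gen1 : sd true 1%N 0%N.
  exists n; first by lia.
  rewrite mulr1 expr1; apply: mem_ideal_gen.
  exact: mem_head.
have gen2 : sd false (h 0) 1%N.
  exists (r 1); first by rewrite muln1 mulnC.
  rewrite expr1; apply: mem_ideal_gen.
  by rewrite /P in_cons mem_head orbT.
have gens_side i j : (0 < i <= q)%N -> (0 < j <= h i)%N ->
    sd (odd i) (convergent 0 1 h i + j * convergent 0 1 h i.+1)%N
      (convergent 1 0 h i + j * convergent 1 0 h i.+1)%N.
  case: i => [|i] lei lej; first by lia.
  have := @convergent_remainderD n m q h s erefl s1 sE i.+1 j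
    ltac:(lia) ltac:(lia).
  rewrite -bE -dE -aE; last by lia.
  have : P (binom_G R lam h r i.+1 j).
    rewrite /P mem_cat; apply/orP; right; apply/allpairsPdep.
    by exists i.+1, j; rewrite !mem_iota; split=> //; lia.
  move=> /mem_ideal_gen; rewrite /binom_G.
  by case: odd => J E; exists (a_exp r i.+1 j).
have total := lifted_total _ _ _ _ _ _ _ _ _ _ _ erefl s1 sE s_last h_gt0
  gen1 gen2 gens_side.
have swap := lifted_total_swap _ _ _ _ _ _ _ _ _ _ _ erefl s1 sE s_last h_gt0
  gen1 gen2 gens_side.
have n_gt0 : (0 < n)%N by exact: ltnW.
have m_gt0 : (0 < m)%N by exact: ltn_trans n_lt_m.
exact: kernel_binomial n_gt0 m_gt0 total swap _ _ _ _ E1 E2.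
Qed.
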